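(* Let $A_q$ be a quantum cluster algebra with initial seed $(\tilde X,\tilde B,\Lambda)$ and a Poisson structure $\{-,-\}$, and let $(\tilde X',\tilde B',\Lambda')$ be a seed mutation equivalent to the initial seed. Assume $\tilde X$ and $\tilde X'$ are log-canonical with respect to $\{-,-\}$ with Poisson matrices $\Omega$ and $\Omega'$ respectively. Then $$\sum_{t:\,\lambda'_{tj}=0}\omega'_{tj}b'_{tk}=0\quad\text{for all } j\in[1,m],\ k\in[1,n],\ j\ne k$$ if and only if $\hat\Omega\tilde B=c\tilde D$ for some $c\in\mathbb Z[q^{\pm\frac12}]$, where $\tilde D=\begin{pmatrix}D\\O\end{pmatrix}_{m\times n}$ with $D$ a skew-symmetrizer of $B$. Moreover, in this case $\hat\Omega'\tilde B'=c\tilde D$.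
   Context: Notation: $[1,m]=\{1,\dots,m\}$; $[a]_+=\max\{a,0\}$, applied componentwise to vectors. Fix $n\le m$. Quantum cluster algebras. $\tilde B=(b_{ij})$ is an $m\times n$ integer matrix whose top $n\times n$ part $B$ is skew-symmetrizable: there is a positive diagonal matrix $D$ (a skew-symmetrizer) with $DB$ skew-symmetric. $\Lambda=(\lambda_{ij})$ is a skew-symmetric $m\times m$ integer matrix such that $(\tilde B,\Lambda)$ is a compatible pair: $\tilde B^\top\Lambda=(D\ \ O)$. Let $q$ be a formal variable. The quantum torus is the $\mathbb Z[q^{\pm 1/2}]$-algebra with basis $X^e$ ($e\in\mathbb Z^m$) and product $X^eX^f=q^{\frac12 e^\top\Lambda f}X^{e+f}$; $\mathscr F_q$ is its skew-field of fractions; $X_i=X^{e_i}$ with $e_i$ the standard basis. A quantum seed is $(\tilde X,\tilde B,\Lambda)$ with extended cluster $\tilde X=(X_1,\dots,X_m)$; $X_1,\dots,X_n$ are cluster variables and $X_{n+1},\dots,X_m$ are frozen. For $k\in[1,n]$ the mutation $\mu_k$ replaces $X_k$ by $X_k'=X^{-e_k+[b_k]_+}+X^{-e_k+[-b_k]_+}$ ($b_k$ the $k$-th column of $\tilde B$), replaces $\tilde B$ by $\tilde B'$ with $b'_{ij}=-b_{ij}$ if $i=k$ or $j=k$ and $b'_{ij}=b_{ij}+\mathrm{sgn}(b_{ik})[b_{ik}b_{kj}]_+$ otherwise, and replaces $\Lambda$ by the skew-symmetric $\Lambda'$ with $\lambda'_{kj}=-\lambda_{kj}+\sum_{l=1}^m[b_{lk}]_+\lambda_{lj}$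 for $j\ne k$ and $\lambda'_{ij}=\lambda_{ij}$ for $i,j\neq k$. The result is again a quantum seed, whose normalized monomials $X'^e$ satisfy the same relation with $\Lambda'$. Seeds related by iterated mutations are mutation equivalent. $A_q$ is the $\mathbb Z[q^{\pm1/2}][X_{n+1}^{\pm1},\dots,X_m^{\pm1}]$-subalgebra of $\mathscr F_q$ generated by all cluster variables of all seeds mutation equivalent to the initial one. Poisson structures. A Poisson structure on an associative algebra over $k=\mathbb Z[q^{\pm1/2}]$ is a $k$-bilinear Lie bracket with $\{a,bc\}=\{a,b\}c+b\{a,c\}$ (the algebra need not be commutative). An extended cluster $\tilde X$ is log-canonical with respect to $\{-,-\}$ if $\{X_i,X_j\}=\omega_{ij}X^{e_i+e_j}$ with $\omega_{ij}\in\mathbb Z[q^{\pm1/2}]$ for all $i,j\in[1,m]$; then $\Omega=(\omega_{ij})$ is its Poisson matrix. For a seed with matrices $\Lambda=(\lambda_{ij})$, $\Omega=(\omega_{ij})$, define $\hat\Omega=(\hat\omega_{ij})$ by $\hat\omega_{ij}=\omega_{ij}$ if $\lambda_{ij}=0$ and $\hat\omega_{ij}=0$ otherwise; $\hat\Omega'$ is defined in the same way from $\Lambda',\Omega'$. *)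

(* Defs.v *)
From HB Require Import structures.
From mathcomp Require Import all_boot all_order all_algebra.
From mathcomp Require Import finmap.
From mathcomp.multinomials Require Import monalg.
From mathcomp Require Import ring.

Set Implicit Arguments.
Unset Strict Implicit.
Unset Printing Implicit Defensive.

Import Order.TTheory GRing.Theory Num.Theory.

Local Open Scope fset_scope.
Local Open Scope ring_scope.

(** * Twisted group algebras

    [twalg s] is the free [R]-module on the group [G] with product
    [<<a>> * <<b>> = s a b *: <<a + b>>].  The ring structure of
    [{malg R[G]}] is not available here, since [monalg] requires an exponent
    monoid without nontrivial units. *)

Record bicharacter (G : zmodType) (R : comNzRingType) := Bicharacter {
  bichar :> G -> G -> R;
  bicharDl : forall a b c, bichar (a + b) c = bichar a c * bichar b c;
  bicharDr : forall a b c, bichar a (b + c) = bichar a b * bichar a c;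
  bichar0l : forall a, bichar 0 a = 1;
  bichar0r : forall a, bichar a 0 = 1 }.

Section TwistedProduct.
Context (G : zmodType) (R : comNzRingType) (s : bicharacter G R).
Implicit Types (g : {malg R[G]}) (a b : G).

Local Notation tw g1 g2 :=
  (fun a b => << g1@_a * g2@_b * s a b *g a + b >>).

Definition twmul g1 g2 : {malg R[G]} :=
  \sum_(a <- msupp g1) \sum_(b <- msupp g2)
     << g1@_a * g2@_b * s a b *g a + b >>.

Definition twone : {malg R[G]} := << 1 *g 0 >>.

Lemma twmulw (d1 d2 : {fset G}) g1 g2 :
  msupp g1 `<=` d1 -> msupp g2 `<=` d2 ->
  twmul g1 g2 = \sum_(a <- d1) \sum_(b <- d2) tw g1 g2 a b.
Proof.
move=> le_d1 le_d2; rewrite /twmul (big_fset_incl _ le_d1) /=.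
  apply/eq_bigr=> a _; apply/big_fset_incl => // b _ /mcoeff_outdom ->.
  by rewrite mulr0 mul0r monalgU0.
move=> a _ /mcoeff_outdom g1a.
by rewrite big1 => // b _; rewrite g1a !mul0r monalgU0.
Qed.

Lemma twmulUU x y a b :
  twmul << x *g a >> << y *g b >> = << x * y * s a b *g a + b >>.
Proof. by rewrite (twmulw msuppU_le msuppU_le) !big_seq_fset1 !mcoeffUU. Qed.

Lemma twmul0g : left_zero 0 twmul.
Proof. by move=> g; rewrite /twmul msupp0 big_seq_fset0. Qed.

Lemma twmulg0 : right_zero 0 twmul.
Proof.
by move=> g; rewrite /twmul big1 // => a _; rewrite msupp0 big_seq_fset0.
Qed.

Lemma twmulDl : left_distributive twmul +%R.
Proof.
move=> g1 g2 g.
rewrite (twmulw (msuppD_le g1 g2) (fsubset_refl _)).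
rewrite (twmulw (fsubsetUl _ (msupp g2)) (fsubset_refl _)).
rewrite (twmulw (fsubsetUr (msupp g1) _) (fsubset_refl _)).
rewrite -big_split /=; apply/eq_bigr=> a _.
rewrite -big_split /=; apply/eq_bigr=> b _.
by rewrite mcoeffD !mulrDl monalgUD.
Qed.

Lemma twmulDr : right_distributive twmul +%R.
Proof.
move=> g g1 g2.
rewrite (twmulw (fsubset_refl _) (msuppD_le g1 g2)).
rewrite (twmulw (fsubset_refl _) (fsubsetUl _ (msupp g2))).
rewrite (twmulw (fsubset_refl _) (fsubsetUr (msupp g1) _)).
rewrite -big_split /=; apply/eq_bigr=> a _.
rewrite -big_split /=; apply/eq_bigr=> b _.
by rewrite mcoeffD mulrDr mulrDl monalgUD.
Qed.

Lemma twmul_suml (I : Type) (r : seq I) (F : I -> {malg R[G]}) g :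
  twmul (\sum_(i <- r) F i) g = \sum_(i <- r) twmul (F i) g.
Proof. exact: (big_morph (twmul^~ g) (fun x y => twmulDl x y g) (twmul0g g)). Qed.

Lemma twmul_sumr (I : Type) (r : seq I) (F : I -> {malg R[G]}) g :
  twmul g (\sum_(i <- r) F i) = \sum_(i <- r) twmul g (F i).
Proof. exact: (big_morph (twmul g) (fun x y => twmulDr g x y) (twmulg0 g)). Qed.

Lemma twmul1g : left_id twone twmul.
Proof.
move=> g; rewrite {1}[g]monalgE twmul_sumr [RHS]monalgE.
by apply/eq_bigr=> a _; rewrite twmulUU bichar0l add0r mulr1 mul1r.
Qed.

Lemma twmulg1 : right_id twone twmul.
Proof.
move=> g; rewrite {1}[g]monalgE twmul_suml [RHS]monalgE.
by apply/eq_bigr=> a _; rewrite twmulUU bichar0r addr0 !mulr1.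
Qed.

Lemma twmulA : associative twmul.
Proof.
move=> g1 g2 g3; rewrite [g1]monalgE !twmul_suml; apply: eq_bigr=> a _.
rewrite [g2]monalgE !(twmul_suml, twmul_sumr); apply: eq_bigr=> b _.
rewrite [g3]monalgE !twmul_sumr; apply: eq_bigr=> c _.
rewrite !twmulUU addrA bicharDl bicharDr; congr << _ *g _ >>.
ring.
Qed.

Lemma twoner_neq0 : twone != 0.
Proof. by rewrite monalgU_eq0 oner_eq0. Qed.

Lemma twmulZl (x : R) g1 g2 : x *: twmul g1 g2 = twmul (x *: g1) g2.
Proof.
rewrite (twmulw (msuppZ_le x g1) (fsubset_refl _)) /twmul scaler_sumr.
apply: eq_bigr=> a _; rewrite scaler_sumr; apply: eq_bigr=> b _.
apply/malgP=> k; rewrite mcoeffZ !mcoeffU mcoeffZ -mulrnAr.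
by case: (_ == _); rewrite ?mulr1n ?mulr0n ?mulr0 // !mulrA.
Qed.

Lemma twmulZr (x : R) g1 g2 : x *: twmul g1 g2 = twmul g1 (x *: g2).
Proof.
rewrite (twmulw (fsubset_refl _) (msuppZ_le x g2)) /twmul scaler_sumr.
apply: eq_bigr=> a _; rewrite scaler_sumr; apply: eq_bigr=> b _.
apply/malgP=> k; rewrite mcoeffZ !mcoeffU mcoeffZ -mulrnAr.
case: (_ == _); rewrite ?mulr1n ?mulr0n ?mulr0 //; ring.
Qed.

Lemma twmulC : (forall a b, s a b = s b a) -> commutative twmul.
Proof.
move=> sC g1 g2; rewrite /twmul exchange_big; apply: eq_bigr=> a _.
by apply: eq_bigr=> b _; rewrite sC addrC [g1@__ * _]mulrC.
Qed.

End TwistedProduct.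

Definition twalg (G : zmodType) (R : comNzRingType) (s : bicharacter G R) :=
  {malg R[G]}.

Section TwistedAlgebra.
Context (G : zmodType) (R : comNzRingType) (s : bicharacter G R).

HB.instance Definition _ := GRing.Lmodule.on (twalg s).
HB.instance Definition _ := GRing.Zmodule_isNzRing.Build (twalg s)
  (twmulA s) (twmul1g s) (twmulg1 s) (twmulDl s) (twmulDr s) (twoner_neq0 G R).
HB.instance Definition _ := GRing.Lmodule_isLalgebra.Build R (twalg s)
  (twmulZl s).
HB.instance Definition _ := GRing.Lalgebra_isAlgebra.Build R (twalg s)
  (twmulZr s).

End TwistedAlgebra.

(** * The ring Z[q^{1/2}, q^{-1/2}] and the quantum torus *)

Definition trivial_bicharacter : bicharacter int int :=
  @Bicharacter int int (fun _ _ => 1)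
    (fun _ _ _ => esym (mulr1 1)) (fun _ _ _ => esym (mulr1 1))
    (fun=> erefl) (fun=> erefl).

Definition qlaurent := twalg trivial_bicharacter.
HB.instance Definition _ := GRing.NzRing.on qlaurent.
HB.instance Definition _ := GRing.PzRing_hasCommutativeMul.Build qlaurent
  (@twmulC _ _ trivial_bicharacter (fun _ _ => erefl)).

(* [qhalf z] is q^{z/2}. *)
Definition qhalf (z : int) : qlaurent := << 1 *g z >>.

Lemma qhalf0 : qhalf 0 = 1. Proof. by []. Qed.

Lemma qhalfD (y z : int) : qhalf (y + z) = qhalf y * qhalf z.
Proof.
rewrite [RHS](twmulUU trivial_bicharacter) /qhalf.
by congr << _ *g _ >>.
Qed.

Section QuantumTorus.
Context (m : nat) (Lam : 'M[int]_m).
Implicit Types e f g : 'cV[int]_m.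

Definition bilin e f : int := (e^T *m Lam *m f) 0 0.

Lemma bilinDl e f g : bilin (e + f) g = bilin e g + bilin f g.
Proof. by rewrite /bilin linearD /= !mulmxDl mxE. Qed.

Lemma bilinDr e f g : bilin e (f + g) = bilin e f + bilin e g.
Proof. by rewrite /bilin mulmxDr mxE. Qed.

Lemma bilin0l e : bilin 0 e = 0.
Proof. by rewrite /bilin trmx0 !mul0mx mxE. Qed.

Lemma bilin0r e : bilin e 0 = 0.
Proof. by rewrite /bilin mulmx0 mxE. Qed.

Definition torus_bicharacter : bicharacter 'cV[int]_m qlaurent.
Proof.
exists (fun e f => qhalf (bilin e f)) => [e f g|e f g|e|e].
- by rewrite bilinDl qhalfD.
- by rewrite bilinDr qhalfD.
- by rewrite bilin0l qhalf0.
- by rewrite bilin0r qhalf0.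
Defined.

Definition qtorus := twalg torus_bicharacter.
HB.instance Definition _ := GRing.Algebra.on qtorus.

Definition Xmon e : qtorus := << 1 *g e >>.

Lemma XmonM e f : Xmon e * Xmon f = qhalf (bilin e f) *: Xmon (e + f).
Proof.
rewrite [LHS](twmulUU torus_bicharacter) !mul1r /=.
apply/malgP=> k; rewrite mcoeffZ !mcoeffU.
by case: (_ == _); rewrite ?mulr1n ?mulr0n ?mulr1 ?mulr0.
Qed.

End QuantumTorus.

(* [F] together with [iota] is a skew-field of fractions of the quantum torus. *)
Definition is_skew_field_of_fractions (m : nat) (Lam : 'M[int]_m)
    (F : unitAlgType qlaurent) (iota : {lrmorphism qtorus Lam -> F}) : Prop :=
  [/\ injective iota,
      forall x : F, x != 0 -> x \is a GRing.unit
    & forall x : F, exists a b : qtorus Lam, b != 0 /\ x = iota a / iota b].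

(** * Compatible pairs

    An extended exchange matrix has size [(n + p) x n]: [n] mutable and [p]
    frozen indices; the mutable index [k : 'I_n] is the row [lshift p k], and
    the principal part is [usubmx B]. *)

Definition skew_symmetrizer (n : nat) (B : 'M[int]_n) (d : 'rV[int]_n) : Prop :=
  (forall i, 0 < d 0 i) /\ (diag_mx d *m B)^T = - (diag_mx d *m B).

Definition compatible_pair (n p : nat) (B : 'M[int]_(n + p, n))
    (Lam : 'M[int]_(n + p)) (d : 'rV[int]_n) : Prop :=
  [/\ skew_symmetrizer (usubmx B) d,
      Lam^T = - Lam
    & B^T *m Lam = row_mx (diag_mx d) 0].

(** * Quantum seeds and their mutations *)

Section Seeds.
Context (n p : nat) (F : unitAlgType qlaurent).

Record qseed := QSeed {
  xcluster : 'I_(n + p) -> F;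
  xmatrix : 'M[int]_(n + p, n);
  qmatrix : 'M[int]_(n + p) }.

(* The normalized monomial X^e of a seed, in terms of its extended cluster:
   q^{-1/2 sum_{i<j} e_i e_j lambda_ij} X_1^{e_1} ... X_m^{e_m}, the
   normalization forced by X^e X^f = q^{1/2 e^T Lambda f} X^{e+f}.  The
   product is taken in increasing order of the indices. *)
Definition nmonomial (s : qseed) (e : 'cV[int]_(n + p)) : F :=
  qhalf (- \sum_(i < n + p) \sum_(j < n + p | (i < j)%N)
             e i 0 * e j 0 * qmatrix s i j)
    *: \prod_(i < n + p) xcluster s i ^ e i 0.

Definition unitv (i : 'I_(n + p)) : 'cV[int]_(n + p) := delta_mx i 0.

Definition pos_part (a : int) : int := Num.max a 0.

Definition mutate_cluster (s : qseed) (k : 'I_n) (i : 'I_(n + p)) : F :=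
  let b := col k (xmatrix s) in
  if i == lshift p k then
    nmonomial s (- unitv (lshift p k) + map_mx pos_part b)
    + nmonomial s (- unitv (lshift p k) + map_mx pos_part (- b))
  else xcluster s i.

Definition mutate_xmatrix (B : 'M[int]_(n + p, n)) (k : 'I_n) :
    'M[int]_(n + p, n) :=
  \matrix_(i, j)
    if (i == lshift p k) || (j == k) then - B i j
    else B i j + Num.sg (B i k) * pos_part (B i k * B (lshift p k) j).

Definition mutate_qmatrix (B : 'M[int]_(n + p, n)) (Lam : 'M[int]_(n + p))
    (k : 'I_n) : 'M[int]_(n + p) :=
  let k' := lshift p k in
  let row_k j := - Lam k' j + \sum_(l < n + p) pos_part (B l k) * Lam l j in
  \matrix_(i, j)
    if i == k' then (if j == k' then 0 else row_k j)
    else if j == k' then - row_k i else Lam i j.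

Definition mutate (s : qseed) (k : 'I_n) : qseed :=
  QSeed (mutate_cluster s k) (mutate_xmatrix (xmatrix s) k)
        (mutate_qmatrix (xmatrix s) (qmatrix s) k).

Inductive mutation_equivalent (s : qseed) : qseed -> Prop :=
| mutation_refl : mutation_equivalent s s
| mutation_step t k :
    mutation_equivalent s t -> mutation_equivalent s (mutate t k).

(** * The quantum cluster algebra and its Poisson structures *)

Inductive qcluster_algebra (s : qseed) : F -> Prop :=
| qca_scalar c : qcluster_algebra s c%:A
| qca_frozen (i : 'I_p) : qcluster_algebra s (xcluster s (rshift n i))
| qca_frozenV (i : 'I_p) : qcluster_algebra s (xcluster s (rshift n i))^-1
| qca_cluster t (i : 'I_n) :
    mutation_equivalent s t -> qcluster_algebra s (xcluster t (lshift p i))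
| qca_add x y :
    qcluster_algebra s x -> qcluster_algebra s y -> qcluster_algebra s (x + y)
| qca_mul x y :
    qcluster_algebra s x -> qcluster_algebra s y -> qcluster_algebra s (x * y).

(* A Poisson structure on the subalgebra [A] of [F]: only the values of [br]
   on [A] are constrained. *)
Record poisson_structure (A : F -> Prop) (br : F -> F -> F) : Prop := {
  poisson_closed : forall x y, A x -> A y -> A (br x y);
  poisson_linl : forall c x y z, A x -> A y -> A z ->
    br (c *: x + y) z = c *: br x z + br y z;
  poisson_linr : forall c x y z, A x -> A y -> A z ->
    br z (c *: x + y) = c *: br z x + br z y;
  poisson_alt : forall x, A x -> br x x = 0;
  poisson_jacobi : forall x y z, A x -> A y -> A z ->
    br x (br y z) + br y (br z x) + br z (br x y) = 0;
  poisson_leibniz : forall x y z, A x -> A y -> A z ->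
    br x (y * z) = br x y * z + y * br x z }.

Definition log_canonical (br : F -> F -> F) (s : qseed)
    (Om : 'M[qlaurent]_(n + p)) : Prop :=
  forall i j, br (xcluster s i) (xcluster s j) =
              Om i j *: nmonomial s (unitv i + unitv j).

End Seeds.

Definition initial_seed (n p : nat) (B : 'M[int]_(n + p, n))
    (Lam : 'M[int]_(n + p)) (F : unitAlgType qlaurent)
    (iota : qtorus Lam -> F) : qseed n p F :=
  QSeed (fun i => iota (Xmon Lam (unitv i))) B Lam.

(* For the initial seed, [nmonomial] is the basis of the quantum torus. *)
Section InitialMonomials.
Context (n p : nat) (B : 'M[int]_(n + p, n)) (Lam : 'M[int]_(n + p)).
Context (F : unitAlgType qlaurent) (iota : {lrmorphism qtorus Lam -> F}).
Context (LamN : Lam^T = - Lam).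

Local Notation Y e := (iota (Xmon Lam e)).

Lemma Xmon0 : Xmon Lam 0 = 1. Proof. by []. Qed.

Lemma iota_XmonM e f : Y e * Y f = qhalf (bilin Lam e f) *: Y (e + f).
Proof. by rewrite -rmorphM XmonM /= linearZZ. Qed.

Lemma bilin_self e : bilin Lam e e = 0.
Proof.
have: bilin Lam e e = - bilin Lam e e.
  rewrite {1}/bilin -[e^T *m Lam *m e]trmxK mxE trmx_mul trmx_mul trmxK LamN.
  by rewrite mulNmx mulmxN mulmxA mxE.
by move/eqP; rewrite -subr_eq0 opprK -mulr2n mulrn_eq0 => /eqP.
Qed.

Lemma bilinMz e f (y z : int) :
  bilin Lam (y *: e) (z *: f) = y * z * bilin Lam e f.
Proof.
by rewrite /bilin [(y *: e)^T]linearZ /= -scalemxAr -!scalemxAl !mxE mulrA [z * y]mulrC.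
Qed.

Lemma iota_XmonX e (z : int) : Y e ^ z = Y (z *: e).
Proof.
have mulz (x y : int) : Y (x *: e) * Y (y *: e) = Y ((x + y) *: e).
  by rewrite iota_XmonM bilinMz bilin_self mulr0 qhalf0 scale1r scalerDl.
have natX (k : nat) : Y e ^+ k = Y (k%:Z *: e).
  elim: k => [|k IHk]; first by rewrite expr0 scale0r Xmon0 rmorph1.
  by rewrite exprS IHk -{1}[e]scale1r mulz.
case: z => k; first exact: natX.
rewrite NegzE -exprnN natX; set x := Y _; set y := Y _.
have xy1 : x * y = 1 by rewrite mulz subrr scale0r Xmon0 rmorph1.
have yx1 : y * x = 1 by rewrite mulz addNr scale0r Xmon0 rmorph1.
have Ux : x \is a GRing.unit by apply/unitrP; exists y.
by rewrite -[LHS]mulr1 -xy1 mulKr.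
Qed.

Lemma iota_Xmon_prod m (f : 'I_m -> 'cV[int]_(n + p)) :
  \prod_(i < m) Y (f i) =
  qhalf (\sum_(i < m) \sum_(j < m | (i < j)%N) bilin Lam (f i) (f j))
    *: Y (\sum_(i < m) f i).
Proof.
elim: m f => [|m IHm] f; first by rewrite !big_ord0 qhalf0 scale1r Xmon0 rmorph1.
have bsum (r : nat) (g : 'I_r -> 'cV[int]_(n + p)) e :
    \sum_(i < r) bilin Lam e (g i) = bilin Lam e (\sum_(i < r) g i).
  by rewrite (big_morph _ (bilinDr Lam e) (bilin0r Lam e)).
rewrite big_ord_recl IHm -scalerAr iota_XmonM scalerA -qhalfD.
congr (qhalf _ *: Y _); last by rewrite big_ord_recl.
rewrite [RHS]big_ord_recl addrC; congr (_ + _).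
  by rewrite [RHS]big_mkcond big_ord_recl /= add0r -bsum.
apply: eq_bigr => i _; rewrite [RHS]big_mkcond big_ord_recl /= add0r.
by rewrite [LHS]big_mkcond.
Qed.

Lemma nmonomial_initial e : nmonomial (initial_seed B iota) e = Y e.
Proof.
rewrite /nmonomial /=.
rewrite (eq_bigr (fun i => Y (e i 0 *: unitv i))) => [|i _]; last exact: iota_XmonX.
rewrite iota_Xmon_prod scalerA -qhalfD.
rewrite [X in qhalf X](_ : _ = 0) ?qhalf0 ?scale1r.
  congr (Y _); apply/colP=> i; rewrite summxE (bigD1 i) //= big1 => [|j nji].
    by rewrite !mxE !eqxx mulr1 addr0.
  by rewrite !mxE eq_sym (negPf nji) mulr0.
rewrite addrC; apply/eqP; rewrite subr_eq0; apply/eqP.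
apply: eq_bigr=> i _; apply: eq_bigr=> j _; rewrite bilinMz; congr (_ * _).
by rewrite /bilin /unitv trmx_delta -rowE -colE !mxE.
Qed.

End InitialMonomials.

Definition hatmx (m : nat) (Lam : 'M[int]_m) (Om : 'M[qlaurent]_m) :
    'M[qlaurent]_m :=
  \matrix_(i, j) if Lam i j == 0 then Om i j else 0.

(* An integer matrix viewed over Z[q^{1/2}, q^{-1/2}]. *)
Definition qlift (r c : nat) (B : 'M[int]_(r, c)) : 'M[qlaurent]_(r, c) :=
  map_mx intr B.

Definition Dtilde (n p : nat) (d : 'rV[int]_n) : 'M[int]_(n + p, n) :=
  col_mx (diag_mx d) 0.

(* Main.v *)
(** Evaluating [{a b, c d}] by the Leibniz rule in both orders gives
    [[a, c] {b, d} = {a, c} [b, d]].  In a skew field, if some [[a, c]] is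
    nonzero, then every commuting pair [b, d] has zero bracket.  The compatibility
    condition makes the torus noncommutative as soon as there is a mutable
    index, and the entries [lambda_ij = 0] correspond to commuting variables in
    every seed; hence both hatted Poisson matrices vanish, and [c] must
    be [0]. *)

Require Import Defs.
From mathcomp Require Import all_boot all_order all_algebra.
From mathcomp Require Import ring zify.
From mathcomp.multinomials Require Import monalg.
Import GRing.Theory Num.Theory.
Local Open Scope ring_scope.

Lemma qhalf_inj : injective qhalf.
Proof.
move=> y z /(congr1 (fun g : {malg int[int]} => g@_y)).
by rewrite /qhalf !mcoeffU eqxx; case: eqP => [->|].
Qed.

Lemma qlaurent_mulr_int_eq0 (c : qlaurent) (z : int) :
  c * z%:~R = 0 -> 0 < z -> c = 0.
Proof.
rewrite mulrzr; case: z => // -[//|z] cz0 _; apply/malgP=> a.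
have := congr1 (fun g : {malg int[int]} => g@_a) cz0.
by rewrite /= mcoeffMn mcoeff0 => /eqP; rewrite mulrn_eq0 /= => /eqP.
Qed.

Lemma qtorus_scale1_eq0 (m : nat) (Lam : 'M[int]_m) (c : qlaurent) :
  c%:A = 0 :> qtorus Lam -> c = 0.
Proof.
move=> /(congr1 (fun g : {malg qlaurent['cV[int]_m]} => g@_0)).
by rewrite mcoeffZ mcoeffU eqxx mulr1 mcoeff0.
Qed.

Section QuasiCommutation.
Context {F : unitAlgType qlaurent}.
Implicit Types (a b : int) (x y : F).

Definition qcomm a x y := x * y = qhalf a *: (y * x).

Lemma qcomm1 y : qcomm 0 1 y.
Proof. by rewrite /qcomm qhalf0 scale1r mul1r mulr1. Qed.

Lemma qcommM a b x1 x2 y :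
  qcomm a x1 y -> qcomm b x2 y -> qcomm (a + b) (x1 * x2) y.
Proof.
rewrite /qcomm => h1 h2.
by rewrite -mulrA h2 -scalerAr 2!mulrA h1 -scalerAl scalerA -qhalfD addrC -!mulrA.
Qed.

Lemma qcomm_sym a x y : qcomm a x y -> qcomm (- a) y x.
Proof. by rewrite /qcomm => ->; rewrite scalerA -qhalfD addNr scale1r. Qed.

Lemma qcommV a x y : x \is a GRing.unit -> qcomm a x y -> qcomm (- a) x^-1 y.
Proof.
rewrite /qcomm => Ux /qcomm_sym h.
by rewrite -[y in LHS](mulrK Ux) h -scalerAl -scalerAr -mulrA mulKr.
Qed.

Lemma qcommXz a x y (z : int) :
  x \is a GRing.unit -> qcomm a x y -> qcomm (z * a) (x ^ z) y.
Proof.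
move=> Ux h.
have natX (k : nat) : qcomm (k%:Z * a) (x ^+ k) y.
  elim: k => [|k IHk]; first by rewrite mul0r; exact: qcomm1.
  by rewrite exprS intS mulrDl mul1r; exact: qcommM.
case: z => k; first exact: natX.
by rewrite NegzE mulNr; apply: qcommV; rewrite ?unitrX.
Qed.

Lemma qcommZ a x y (c : qlaurent) : qcomm a x y -> qcomm a (c *: x) y.
Proof.
by rewrite /qcomm -scalerAl -scalerAr => ->; rewrite !scalerA mulrC.
Qed.

Lemma qcommD a x1 x2 y : qcomm a x1 y -> qcomm a x2 y -> qcomm a (x1 + x2) y.
Proof. by rewrite /qcomm mulrDl mulrDr scalerDr => -> ->. Qed.

Lemma qcommN a x y : qcomm a x y -> qcomm a (- x) y.
Proof. by rewrite -scaleN1r; exact: qcommZ. Qed.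

Lemma qcomm_prod (I : Type) (r : seq I) (a : I -> int) (f : I -> F) y :
  (forall i, qcomm (a i) (f i) y) ->
  qcomm (\sum_(i <- r) a i) (\prod_(i <- r) f i) y.
Proof.
move=> h; elim: r => [|i r IHr]; first by rewrite !big_nil; exact: qcomm1.
by rewrite !big_cons; exact: qcommM.
Qed.

End QuasiCommutation.

Section PoissonRigidity.
Context {n p : nat} {F : unitAlgType qlaurent} {s : qseed n p F}.
Context {br : F -> F -> F} (hbr : poisson_structure (qcluster_algebra s) br).
Local Notation A := (qcluster_algebra s).

Lemma poisson_addl x y z : A x -> A y -> A z ->
  br (x + y) z = br x z + br y z.
Proof. by move=> *; rewrite -[x]scale1r (poisson_linl hbr) // !scale1r. Qed.

Lemma poisson_addr x y z : A x -> A y -> A z ->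
  br z (x + y) = br z x + br z y.
Proof. by move=> *; rewrite -[x]scale1r (poisson_linr hbr) // !scale1r. Qed.

Lemma poisson_anti x y : A x -> A y -> br x y = - br y x.
Proof.
move=> Ax Ay; have Axy := qca_add Ax Ay; apply/eqP; rewrite -addr_eq0.
have := poisson_alt hbr Axy.
rewrite poisson_addl // !poisson_addr // !(poisson_alt hbr) //.
by rewrite add0r addr0 => ->.
Qed.

Lemma poisson_leibnizl x y z : A x -> A y -> A z ->
  br (x * y) z = br x z * y + x * br y z.
Proof.
move=> Ax Ay Az; rewrite poisson_anti ?(poisson_leibniz hbr) //; last exact: qca_mul.
by rewrite (poisson_anti x z Ax Az) (poisson_anti y z Ay Az) mulNr mulrN opprD.
Qed.

Lemma poisson_commutator a b c d : A a -> A b -> A c -> A d ->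
  (a * c - c * a) * br b d = br a c * (b * d - d * b).
Proof.
move=> Aa Ab Ac Ad; have Acd := qca_mul Ac Ad; have Aab := qca_mul Aa Ab.
have := poisson_leibniz hbr Aab Ac Ad.
rewrite poisson_leibnizl // !(poisson_leibniz hbr) // !poisson_leibnizl //.
rewrite !(mulrDl, mulrDr, mulNr, mulrN) !mulrA.
set t1 := br a c * d * b; set t2 := c * br a d * b.
set t3 := a * br b c * d; set t4 := a * c * br b d.
set t5 := br a c * b * d; set t6 := c * a * br b d => h.
have /addIr {}h : t4 + t1 + (t2 + t3) = t5 + t6 + (t2 + t3).
  by rewrite [LHS](AC (2*2) ((2*3)*(4*1))) /= h [LHS](AC (2*2) ((1*4)*(3*2))).
by apply/eqP; rewrite subr_eq addrAC eq_sym subr_eq h.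
Qed.

End PoissonRigidity.

Lemma pos_partE (a : int) : pos_part a = if 0 <= a then a else 0.
Proof.
by rewrite /pos_part; case: (Order.TotalTheory.leP 0 a) => ?; lia.
Qed.

Lemma sgz_pos_partM (a b : int) :
  Num.sg a * pos_part (a * b) = pos_part a * b + a * pos_part (- b).
Proof.
rewrite !pos_partE; case: (sgrP a) => [->|a0|a0]; rewrite ?mul0r //.
all: case: (Order.TotalTheory.leP 0 b) => b0; have [] : 0 <= a * b \/ a * b <= 0 by nia.
all: repeat (case: ifP); nia.
Qed.

Lemma row_diag_mxE (n p : nat) (d : 'rV[int]_n) i (j : 'I_(n + p)) :
  row_mx (diag_mx d) 0 i j = if j == lshift p i then d 0 i else 0.
Proof.
rewrite mxE; case: splitP => j' jj'.
  have -> : j = lshift p j' by apply: val_inj.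
  by rewrite (inj_eq (@lshift_inj _ _)) mxE [j' == i]eq_sym; case: eqP => [->|].
have -> : j = rshift n j' by apply: val_inj.
by rewrite eq_rlshift mxE.
Qed.

Section MatrixMutation.
Context {n p : nat} {B : 'M[int]_(n + p, n)} {Lam : 'M[int]_(n + p)}.
Context {d : 'rV[int]_n} (LamN : Lam^T = - Lam).
Context (BLam : B^T *m Lam = row_mx (diag_mx d) 0) (k : 'I_n).
Context (d_gt0 : forall i, 0 < d 0 i).
Local Notation k' := (lshift p k).

Lemma compatibleE i (j : 'I_(n + p)) :
  \sum_l B l i * Lam l j = if j == lshift p i then d 0 i else 0.
Proof.
rewrite -row_diag_mxE -BLam mxE.
by apply: eq_bigr => l _; rewrite mxE.
Qed.

Lemma qmatrix_skew i j : Lam j i = - Lam i j.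
Proof. by have /matrixP/(_ i j) := LamN; rewrite !mxE. Qed.

Lemma compatible_skew i j :
  d 0 i * B (lshift p i) j = - (d 0 j * B (lshift p j) i).
Proof.
have h : diag_mx d *m usubmx B = B^T *m Lam *m B.
  by rewrite BLam -{2}[B]vsubmxK mul_row_col mul0mx addr0.
have : (B^T *m Lam *m B)^T = - (B^T *m Lam *m B).
  by rewrite !trmx_mul trmxK LamN mulNmx mulmxN mulmxA.
by rewrite -h => /matrixP/(_ j i); rewrite !mul_diag_mx !mxE.
Qed.

Lemma compatible_diag0 : B k' k = 0.
Proof. by have := compatible_skew k k; have := d_gt0 k; nia. Qed.

(* The mutated matrices are [E B M] and [E^T Lam E], where [E] and
   [M] are involutions differing from the identity in column [k] and row [k]
   respectively. *)
Let v : 'cV[int]_(n + p) :=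
  \col_i (pos_part (B i k) - (i == k')%:R *+ 2).
Let w : 'rV[int]_n :=
  \row_j (pos_part (- B k' j) - (j == k)%:R *+ 2).
Let E := 1%:M + v *m delta_mx 0 k'.
Let M := 1%:M + delta_mx k 0 *m w.

Let vk : v k' 0 = - 2.
Proof. by rewrite mxE compatible_diag0 eqxx. Qed.

Lemma mutate_xmatrixE : mutate_xmatrix B k = E *m B *m M.
Proof.
rewrite /E /M mulmxDl mul1mx -mulmxA -rowE mulmxDr mulmx1 mulmxA -colE.
apply/matrixP=> i j; rewrite !mxE !big_ord1 !mxE big_ord1 !mxE.
have pos0 : pos_part 0 = 0 by [].
rewrite compatible_diag0 sgz_pos_partM.
have [->|ik] /= := eqVneq i k'; first by rewrite compatible_diag0 pos0; ring.
have [->|jk] /= := eqVneq j k; last by ring.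
by rewrite compatible_diag0 oppr0 pos0; ring.
Qed.

Lemma mutate_qmatrixE : mutate_qmatrix B Lam k = E^T *m Lam *m E.
Proof.
have vLam j : \sum_l v l 0 * Lam l j =
    - Lam k' j *+ 2 + \sum_l pos_part (B l k) * Lam l j.
  under eq_bigr do rewrite mxE mulrBl.
  rewrite sumrB addrC (bigD1 k') //= big1 => [|i /negPf ->]; last first.
    by rewrite mul0rn mul0r.
  by rewrite eqxx addr0 mulNrn mulrnAl mul1r.
have ELamE i j : j != k' -> (E^T *m Lam *m E) i j =
    Lam i j + (i == k')%:R * \sum_l v l 0 * Lam l j.
  move=> /negPf jk; rewrite {2}/E mulmxDr mulmx1 mulmxA mxE [X in _ + X]mxE.
  rewrite big_ord1 [delta_mx _ _ _ _]mxE jk andbF mulr0 addr0.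
  rewrite /E linearD /= trmx1 trmx_mul trmx_delta mulmxDl mul1mx mxE -mulmxA.
  congr (_ + _); rewrite !mxE big_ord1 !mxE eqxx andbT.
  by congr (_ * _); apply: eq_bigr => l _; rewrite mxE.
have ELam_skew i j : (E^T *m Lam *m E) i j = - (E^T *m Lam *m E) j i.
  have /matrixP/(_ j i) : (E^T *m Lam *m E)^T = - (E^T *m Lam *m E).
    by rewrite !trmx_mul trmxK LamN mulNmx mulmxN mulmxA.
  by rewrite mxE => ->; rewrite mxE.
apply/matrixP=> i j; rewrite mxE.
have [->|ik] := eqVneq i k'; have [->|jk] := eqVneq j k'.
- by have := ELam_skew k' k'; rewrite /=; lia.
- by rewrite ELamE // eqxx mul1r vLam; ring.
- by rewrite ELam_skew ELamE // eqxx mul1r vLam; ring.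
- by rewrite ELamE // (negPf ik) mul0r addr0.
Qed.

Lemma mutate_qmatrix_skew :
  (mutate_qmatrix B Lam k)^T = - mutate_qmatrix B Lam k.
Proof.
by rewrite mutate_qmatrixE !trmx_mul trmxK LamN mulNmx mulmxN mulmxA.
Qed.

Lemma mutate_compatible :
  (mutate_xmatrix B k)^T *m mutate_qmatrix B Lam k = row_mx (diag_mx d) 0.
Proof.
have EE : E *m E = 1%:M.
  rewrite {1}/E mulmxDl mul1mx -mulmxA -rowE; apply/matrixP=> i j.
  rewrite /E !mxE !big_ord1 [row _ _ _ _]mxE !mxE big_ord1 vk !mxE.
  by rewrite [k' == j]eq_sym /=; ring.
rewrite mutate_xmatrixE mutate_qmatrixE !trmx_mul.
rewrite -!mulmxA (mulmxA E^T E^T) -trmx_mul EE trmx1 mul1mx (mulmxA B^T) BLam.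
rewrite /M linearD /= trmx1 trmx_mul trmx_delta mulmxDl mul1mx -mulmxA -rowE.
rewrite /E mulmxDr mulmx1 mulmxA.
have -> : row_mx (diag_mx d) 0 *m v = \col_i (d 0 i * v (lshift p i) 0).
  rewrite -{1}[v]vsubmxK mul_row_col mul0mx addr0 mul_diag_mx.
  by apply/colP=> i; rewrite !mxE.
move: (row_mx _ _) (@row_diag_mxE n p d) => R RE; apply/matrixP=> i j.
rewrite !mxE !big_ord1 !mxE big_ord1 !mxE !RE compatible_diag0 (inj_eq (@lshift_inj _ _)).
have [_|_] := eqVneq j k'; last by rewrite /=; ring.
have [->|ik] := eqVneq i k.
  by rewrite compatible_diag0 oppr0 (_ : pos_part 0 = 0) // eqxx /=; ring.
have h : d 0 i * pos_part (B (lshift p i) k) = d 0 k * pos_part (- B k' i).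
  have := compatible_skew i k; rewrite !pos_partE.
  by have := d_gt0 i; have := d_gt0 k; do 2 case: ifP; nia.
rewrite (_ : pos_part 0 = 0) // eqxx /=; move: h; move: (pos_part _) => x.
by rewrite mulr0n subr0 => ->; ring.
Qed.

End MatrixMutation.

Record quasi_commuting_seed {n p : nat} {F : unitAlgType qlaurent}
    (d : 'rV[int]_n) (s : qseed n p F) : Prop := QuasiCommutingSeed {
  qcs_skew : (qmatrix s)^T = - qmatrix s;
  qcs_compatible : (xmatrix s)^T *m qmatrix s = row_mx (diag_mx d) 0;
  qcs_unit : forall i, xcluster s i \is a GRing.unit;
  qcs_qcomm : forall i j,
    qcomm (2 * qmatrix s i j) (xcluster s i) (xcluster s j) }.

Section SeedMutation.
Context {n p : nat} {F : unitAlgType qlaurent} {d : 'rV[int]_n}.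
Context (d_gt0 : forall i, 0 < d 0 i).
Context (unitF : forall x : F, x != 0 -> x \is a GRing.unit).
Context (scaleF : forall c : qlaurent, c%:A = 0 :> F -> c = 0).
Implicit Types (s : qseed n p F) (x y : F).

Lemma scale_unit_eq0 (c : qlaurent) x : x \is a GRing.unit -> c *: x = 0 -> c = 0.
Proof.
by move=> Ux cx0; apply: scaleF; rewrite -[1](mulrV Ux) scalerAl cx0 mul0r.
Qed.

Lemma nmonomial_unit s e : (forall i, xcluster s i \is a GRing.unit) ->
  nmonomial s e \is a GRing.unit.
Proof.
move=> Ux; rewrite /nmonomial; set z := - _; set y := \prod_(_ < _) _.
have Uy : y \is a GRing.unit by apply: unitr_prod => i _; exact: unitrXz.
apply/unitrP; exists (qhalf (- z) *: y^-1).
rewrite -!scalerAl -!scalerAr !scalerA -!qhalfD addNr subrr qhalf0 !scale1r.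
by rewrite mulVr ?mulrV.
Qed.

Lemma nmonomial_qcomm s (e : 'cV[int]_(n + p)) j : quasi_commuting_seed d s ->
  qcomm (2 * \sum_i e i 0 * qmatrix s i j) (nmonomial s e) (xcluster s j).
Proof.
move=> hs; apply: qcommZ; rewrite mulr_sumr; apply: qcomm_prod => i.
by rewrite mulrCA; apply: qcommXz; [exact: qcs_unit hs i | exact: qcs_qcomm hs i j].
Qed.

Lemma qcomm_inj a b x y : x \is a GRing.unit -> y \is a GRing.unit ->
  qcomm a x y -> qcomm b x y -> a = b.
Proof.
move=> Ux Uy; rewrite /qcomm => -> /eqP; rewrite -subr_eq0 -scalerBl => /eqP h.
apply: qhalf_inj; apply/eqP; rewrite -subr_eq0; apply/eqP.
by apply: scale_unit_eq0 h; rewrite unitrMr.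
Qed.

Lemma mutate_quasi_commuting s k :
  quasi_commuting_seed d s -> quasi_commuting_seed d (mutate s k).
Proof.
move=> hs; have [LamN BLam Ux xC] := hs.
set k' := lshift p k; set x' := mutate_cluster s k k'.
set e1 := - unitv k' + map_mx pos_part (col k (xmatrix s)).
set e2 := - unitv k' + map_mx pos_part (- col k (xmatrix s)).
have x'E : x' = nmonomial s e1 + nmonomial s e2.
  by rewrite /x' /mutate_cluster eqxx.
pose a1 j := \sum_i e1 i 0 * qmatrix s i j.
pose a2 j := \sum_i e2 i 0 * qmatrix s i j.
have a12 j : a1 j = a2 j + if j == k' then d 0 k else 0.
  rewrite -(compatibleE BLam) -big_split /=; apply: eq_bigr => i _.
  rewrite !mxE !pos_partE -mulrDl; congr (_ * _); do 2 case: ifP; lia.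
have a1E j : a1 j = - qmatrix s k' j +
    \sum_l pos_part (xmatrix s l k) * qmatrix s l j.
  rewrite /a1; under eq_bigr do rewrite !mxE mulrDl mulNr.
  rewrite big_split /= sumrN; congr (- _ + _).
  rewrite (bigD1 k') //= eqxx mul1r big1 ?addr0 // => i /negPf ->.
  by rewrite mul0r.
have Ux' : x' \is a GRing.unit.
  apply: unitF; apply/eqP=> x'0; have U1 := nmonomial_unit s e1 Ux.
  have h2 : qcomm (2 * a2 k') (nmonomial s e1) (xcluster s k').
    have -> : nmonomial s e1 = - nmonomial s e2.
      by apply/eqP; rewrite -addr_eq0 -x'E x'0.
    by apply: qcommN; exact: nmonomial_qcomm.
  have := qcomm_inj _ _ _ _ U1 (Ux k') (nmonomial_qcomm s e1 k' hs) h2.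
  by rewrite -/(a1 _) a12 eqxx; have := d_gt0 k; lia.
have x'C j : j != k' -> qcomm (2 * a1 j) x' (xcluster s j).
  move=> jk; rewrite x'E; apply: qcommD; first exact: nmonomial_qcomm.
  by rewrite a12 (negPf jk) addr0; exact: nmonomial_qcomm.
split=> [||i|i j] /=.
- exact: mutate_qmatrix_skew LamN BLam k d_gt0.
- exact: mutate_compatible LamN BLam k d_gt0.
- have [->|ik] := eqVneq i k'; first exact: Ux'.
  by rewrite /mutate_cluster (negPf ik).
rewrite mxE -/k'; have [->|ik] := eqVneq i k'; have [->|jk] := eqVneq j k'.
- by rewrite mulr0 /qcomm qhalf0 scale1r.
- by rewrite -a1E {2}/mutate_cluster (negPf jk); exact: x'C.
- rewrite -a1E mulrN; apply: qcomm_sym.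
  by rewrite {2}/mutate_cluster (negPf ik); exact: x'C.
- by rewrite /mutate_cluster (negPf ik) (negPf jk).
Qed.

Lemma mutation_equivalent_quasi_commuting s s' :
  mutation_equivalent s s' -> quasi_commuting_seed d s ->
  quasi_commuting_seed d s'.
Proof. by move=> h hs; elim: h => // t k _; exact: mutate_quasi_commuting. Qed.

Lemma qcluster_algebra_xcluster s s' i :
  mutation_equivalent s s' -> qcluster_algebra s (xcluster s' i).
Proof.
move=> h; case: (splitP i) => j ij.
  have -> : i = lshift p j by apply: val_inj.
  exact: qca_cluster.
have -> : i = rshift n j by apply: val_inj.
elim: h => [|t k _ IH]; first exact: qca_frozen.
by rewrite /= /mutate_cluster eq_rlshift.
Qed.

Lemma log_canonical_hatmx_eq0 (br : F -> F -> F) s s' Om (k : 'I_n) :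
  poisson_structure (qcluster_algebra s) br -> quasi_commuting_seed d s ->
  mutation_equivalent s s' -> log_canonical br s' Om ->
  hatmx (qmatrix s') Om = 0.
Proof.
move=> hbr hs hss' hOm; have hs' := mutation_equivalent_quasi_commuting s s' hss' hs.
have As i : qcluster_algebra s (xcluster s i).
  by apply: qcluster_algebra_xcluster; exact: mutation_refl.
have As' i := qcluster_algebra_xcluster s s' i hss'.
have [l Llk] : exists l, qmatrix s l (lshift p k) != 0.
  apply/existsP; apply: contraT => /existsPn L0.
  have := compatibleE (qcs_compatible d s hs) k (lshift p k).
  rewrite eqxx big1 => [|l _]; first by have := d_gt0 k; lia.
  by have := L0 l; rewrite negbK => /eqP ->; rewrite mulr0.
set a := xcluster s l; set c := xcluster s (lshift p k).
have Uac : a * c - c * a \is a GRing.unit.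
  apply: unitF; apply/eqP => /eqP; rewrite subr_eq0 => /eqP ac.
  have ac0 : qcomm 0 a c by rewrite /qcomm qhalf0 scale1r.
  have := qcomm_inj _ _ _ _ (qcs_unit d s hs _) (qcs_unit d s hs _)
    (qcs_qcomm d s hs l (lshift p k)) ac0.
  by move/eqP: Llk; lia.
apply/matrixP=> i j; rewrite !mxE; case: eqP => // Lij0.
have xij : xcluster s' i * xcluster s' j = xcluster s' j * xcluster s' i.
  by rewrite (qcs_qcomm d s' hs') Lij0 mulr0 qhalf0 scale1r.
have := poisson_commutator hbr _ _ _ _ (As l) (As' i) (As (lshift p k)) (As' j).
rewrite xij subrr mulr0 hOm -(mulr0 (a * c - c * a)) => /(mulrI Uac).
by apply: scale_unit_eq0; apply: nmonomial_unit; exact: qcs_unit hs'.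
Qed.

End SeedMutation.

Lemma initial_quasi_commuting (n p : nat) (B : 'M[int]_(n + p, n))
    (Lam : 'M[int]_(n + p)) (d : 'rV[int]_n) (F : unitAlgType qlaurent)
    (iota : {lrmorphism qtorus Lam -> F}) :
  Lam^T = - Lam -> B^T *m Lam = row_mx (diag_mx d) 0 ->
  quasi_commuting_seed d (initial_seed B iota).
Proof.
move=> LamN BLam; split=> //= [i|i j].
  pose Y x := iota (Xmon Lam (x *: unitv i)).
  have YN x y : x + y = 0 -> Y x * Y y = 1.
    move=> xy0; rewrite /Y iota_XmonM bilinMz bilin_self // mulr0 qhalf0 scale1r.
    by rewrite -scalerDl xy0 scale0r Xmon0 rmorph1.
  have -> : Xmon Lam (unitv i) = Xmon Lam (1 *: unitv i) by rewrite scale1r.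
  by apply/unitrP; exists (Y (- 1)); rewrite !(YN, addNr, subrr).
have bilin_unitv k l : bilin Lam (unitv k) (unitv l) = Lam k l.
  by rewrite /bilin /unitv trmx_delta -rowE -colE !mxE.
rewrite /qcomm !iota_XmonM scalerA -qhalfD !bilin_unitv addrC.
by congr (qhalf _ *: _); rewrite (qmatrix_skew LamN i j); lia.
Qed.

Theorem lemma4p1 (n p : nat) (B : 'M[int]_(n + p, n)) (Lam : 'M[int]_(n + p))
    (d0 : 'rV[int]_n) (hcompat : compatible_pair B Lam d0)
    (F : unitAlgType qlaurent) (iota : {lrmorphism qtorus Lam -> F})
    (hF : is_skew_field_of_fractions iota)
    (br : F -> F -> F)
    (hbr : poisson_structure (qcluster_algebra (initial_seed B iota)) br)
    (s' : qseed n p F)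
    (hs' : mutation_equivalent (initial_seed B iota) s')
    (Om Om' : 'M[qlaurent]_(n + p))
    (hOm : log_canonical br (initial_seed B iota) Om)
    (hOm' : log_canonical br s' Om')
    (d : 'rV[int]_n) (hd : skew_symmetrizer (usubmx B) d) :
  ((forall (j : 'I_(n + p)) (k : 'I_n), j != lshift p k ->
      \sum_(t < n + p | qmatrix s' t j == 0)
         Om' t j * (xmatrix s' t k)%:~R = 0)
   <->
   (exists c : qlaurent, hatmx Lam Om *m qlift B = c *: qlift (Dtilde p d)))
  /\
  (forall c : qlaurent,
     hatmx Lam Om *m qlift B = c *: qlift (Dtilde p d) ->
     hatmx (qmatrix s') Om' *m qlift (xmatrix s') = c *: qlift (Dtilde p d)).
Proof.
have [[d0_gt0 _] LamN BLam] := hcompat; have [iota_inj unitF _] := hF.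
have scaleF (c : qlaurent) : c%:A = 0 :> F -> c = 0.
  move=> c0; apply: (@qtorus_scale1_eq0 _ Lam); apply: iota_inj.
  by rewrite rmorph0 linearZ rmorph1.
have hs := initial_quasi_commuting n p B Lam d0 F iota LamN BLam.
have hat0 (k : 'I_n) : hatmx Lam Om = 0.
  exact: log_canonical_hatmx_eq0 d0_gt0 unitF scaleF _ _ _ _ k hbr hs (mutation_refl _) hOm.
have hat'0 (k : 'I_n) : hatmx (qmatrix s') Om' = 0.
  exact: log_canonical_hatmx_eq0 d0_gt0 unitF scaleF _ _ _ _ k hbr hs hs' hOm'.
split; first split=> [_|_ j k _].
- by exists 0; apply/matrixP=> i k; rewrite (hat0 k) mul0mx scale0r.
- apply: big1 => t Ltj; have /matrixP/(_ t j) := hat'0 k.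
  by rewrite !mxE Ltj => ->; rewrite mul0r.
move=> c hc; apply/matrixP=> i k; move: hc.
rewrite (hat0 k) (hat'0 k) !mul0mx => hc.
suff -> : c = 0 by rewrite scale0r.
have [d_gt0 _] := hd.
apply: qlaurent_mulr_int_eq0 (d_gt0 k).
have /matrixP/(_ (lshift p k) k) := hc.
by rewrite !mxE (unsplitK (inl _)) mxE eqxx.
Qed.
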